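(* Let $\{x_k\}_{k\ge-1}$, with gradients $g_k=g(x_k)$, be a post-warm-up tail (as defined in the context) with finite spectral set $\Lambda$, whose steps are given by a fixed positive weighted delayed Rayleigh rule $$\alpha_k^{\Psi}=\frac{g_{k-1}^{\mathsf T}\Psi(H)g_{k-1}}{g_{k-1}^{\mathsf T}\Psi(H)Hg_{k-1}}\quad(k\ge0),\qquad \Psi(\lambda)>0\ \ (\lambda\in\Lambda).$$ Then there exist constants $C<\infty$ and $\rho\in(0,1)$, depending only on $\Lambda$ and $\Psi$, such that $$\|g_k\|\le C\rho^k\|g_0\|\qquad(k\ge0).$$ Consequently, the errors converge $R$-linearly with factor $\rho$ (i.e. there is a constant $C'<\infty$ with $\|x_k-x_*\|\le C'\rho^k$ for all $k\ge0$), and the objective gaps converge $R$-linearly with factor $\rho^2$ (i.e. there is a constant $C''<\infty$ with $f(x_k)-f(x_* )\le C''\rho^{2k}$ for all $k\ge0$). In particular, this holds for the BB2 rule $\alpha_k=\dfrac{g_{k-1}^{\mathsf T}Hg_{k-1}}{g_{k-1}^{\mathsf T}H^2g_{k-1}}$.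
   Context: Setting. $H\in\mathbb{R}^{d\times d}$ is symmetric positive definite, $q\in\mathbb{R}^d$, $f(x)=\frac12 x^{\mathsf T}Hx-q^{\mathsf T}x$, $x_*=H^{-1}q$, and $g(x)=\nabla f(x)=H(x-x_* )$. $\|\cdot\|$ is the Euclidean norm. For $\lambda\in\operatorname{spec}(H)$, $P_\lambda$ is the orthogonal projector onto the eigenspace of $\lambda$. For a nonzero vector $v$, $\Lambda(v)=\{\lambda\in\operatorname{spec}(H):P_\lambda v\neq 0\}$. $\Psi(H)=\sum_\lambda\Psi(\lambda)P_\lambda$. Post-warm-up tail. A sequence $\{x_k\}_{k\ge -1}$ with $g_k=g(x_k)$ such that: $x_0=x_{-1}-\hat\alpha g_{-1}$ for some real $\hat\alpha$ (the warm-up step), so $g_0=(I-\hat\alpha H)g_{-1}$; the set $\Lambda:=\Lambda(g_{-1})$ has $|\Lambda|\ge 2$; with $a:=\min\Lambda$ and $b:=\max\Lambda$ one has $P_ag_j\neq 0$ and $P_bg_j\ne 0$ for $j=-1,0$; and for every $k\ge 0$, $x_{k+1}=x_k-\alpha_kg_k$, so $g_{k+1}=(I-\alpha_kH)g_k$, where $\alpha_k$ is given by the chosen delayed rule. *)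

(* Defs.v *)
From HB Require Import structures.
From mathcomp Require Import all_boot all_order all_algebra.
From mathcomp Require Import ring lra.
From mathcomp Require Import all_classical all_reals all_analysis.
Import Order.TTheory GRing.Theory Num.Theory.
Import numFieldNormedType.Exports.

Set Implicit Arguments.
Unset Strict Implicit.
Unset Printing Implicit Defensive.

Local Open Scope classical_set_scope.
Local Open Scope ring_scope.

Section Quadratic.
Context {R : realType} {d : nat}.
Implicit Types (H : 'M[R]_d) (q v w x : 'cV[R]_d).

Definition dot v w : R := (v^T *m w) 0 0.

(* The library norm on matrices is the sup norm, hence this one. *)
Definition enorm v : R := Num.sqrt (dot v v).

Definition spd H : Prop := H^T = H /\ forall v, v != 0 -> 0 < dot v (H *m v).

Definition obj H q x : R := 2^-1 * dot x (H *m x) - dot q x.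

Definition xstar H q : 'cV[R]_d := invmx H *m q.

(* The gradient of [obj H q], see [is_derive_obj]. *)
Definition grad H q x : 'cV[R]_d := H *m (x - xstar H q).

Definition spec H : set R := [set l | eigenvalue H l].

(* [eigenspace H l] holds row vectors, on which projectors act from the right,
   and [kermx E^T] is the orthogonal complement of the row space of [E]. The
   outer transpose makes the projector act on column vectors from the left;
   for symmetric [H], left and right eigenvectors agree.
   See [eigenprojP] and [eigenproj_orthogonal]. *)
Definition eigenproj H (l : R) : 'M[R]_d :=
  (proj_mx (eigenspace H l) (kermx (eigenspace H l)^T))^T.

Definition active H v : set R := [set l | spec H l /\ eigenproj H l *m v != 0].

(* The sum has finite support, see [finite_spec]. *)
Definition spectral_fun (Psi : R -> R) H : 'M[R]_d :=
  \sum_(l \in spec H) Psi l *: eigenproj H l.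

Definition rayleigh_step (Psi : R -> R) H v : R :=
  dot v (spectral_fun Psi H *m v) / dot v (spectral_fun Psi H *m H *m v).

Definition bb2_step H v : R := dot v (H *m v) / dot v (H ^+ 2 *m v).

(* [x] is indexed by [int] so that it can start at [-1]; its values below [-1]
   are never constrained or used. [step v] is the step size computed from the
   previous gradient [v]. *)
Record post_warm_up_tail H q (Lam : set R) (step : 'cV[R]_d -> R)
    (x : int -> 'cV[R]_d) : Prop := PostWarmUpTail {
  tail_warm_up : exists ahat : R, x 0 = x (-1) - ahat *: grad H q (x (-1));
  tail_active : active H (grad H q (x (-1))) = Lam;
  tail_card : (`I_2 #<= Lam)%card;
  tail_extremal : exists a b : R,
    [/\ Lam a /\ lbound Lam a,
        Lam b /\ ubound Lam b &
        forall j : int, j = -1 \/ j = 0 ->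
          eigenproj H a *m grad H q (x j) != 0 /\
          eigenproj H b *m grad H q (x j) != 0];
  tail_step : forall k : nat,
    x (k%:Z + 1) = x k%:Z - step (grad H q (x (k%:Z - 1))) *: grad H q (x k%:Z)
}.

End Quadratic.

Section Facts.
Context {R : realType} {d : nat}.
Implicit Types (H : 'M[R]_d) (q v w x : 'cV[R]_d).

Lemma dotC v w : dot v w = dot w v.
Proof. by rewrite /dot !mxE; apply: eq_bigr => i _; rewrite !mxE mulrC. Qed.

Lemma dotDr u v w : dot u (v + w) = dot u v + dot u w.
Proof. by rewrite /dot mulmxDr mxE. Qed.

Lemma dotZr a u v : dot u (a *: v) = a * dot u v.
Proof. by rewrite /dot -scalemxAr mxE. Qed.

Lemma dot_eq0 v : dot v v = 0 -> v = 0.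
Proof.
rewrite /dot mxE => /eqP; rewrite psumr_eq0; last first.
  by move=> i _; rewrite mxE -expr2 sqr_ge0.
move=> /allP h; apply/colP => i; rewrite mxE.
by have := h i (mem_index_enum _); rewrite /= mxE -expr2 sqrf_eq0 => /eqP.
Qed.

Lemma spd_unit H : spd H -> H \in unitmx.
Proof.
move=> [Hs Hp]; rewrite -row_free_unit -kermx_eq0; apply/rowV0P => u.
move=> /sub_kermxP uH; apply/eqP/contraT => u0.
have ut0 : u^T != 0 by rewrite -(inj_eq trmx_inj) trmxK trmx0.
by have := Hp _ ut0; rewrite /dot trmxK mulmxA uH mul0mx mxE ltxx.
Qed.

Lemma objD H q x v : spd H ->
  obj H q (x + v) = obj H q x + dot (grad H q x) v + 2^-1 * dot v (H *m v).
Proof.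
move=> sH; have [Hs _] := sH.
rewrite /obj /grad /xstar mulmxBr mulmxA mulmxV ?spd_unit// mul1mx.
have E : dot v (H *m x) = dot x (H *m v).
  by rewrite dotC /dot trmx_mul Hs mulmxA.
have -> : dot (H *m x - q) v = dot x (H *m v) - dot q v.
  by rewrite dotC -scaleN1r dotDr dotZr E mulN1r (dotC v).
rewrite mulmxDr !dotDr !(dotC (x + v)) !dotDr !(dotC (H *m _)) E.
by field.
Qed.

Lemma is_derive_obj H q x v : spd H ->
  is_derive x v (obj H q) (dot (grad H q x) v).
Proof.
move=> sH.
have C : (fun h : R => h^-1 *: ((obj H q \o shift x) (h *: v) - obj H q x))
    @ 0^' --> dot (grad H q x) v.
  have L : (fun h : R => dot (grad H q x) v + h * (2^-1 * dot v (H *m v)))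
      @ 0^' --> dot (grad H q x) v.
    have c : (fun h : R => dot (grad H q x) v + h * (2^-1 * dot v (H *m v)))
        @ (0 : R) --> dot (grad H q x) v + 0 * (2^-1 * dot v (H *m v)).
      by apply: cvgD; [exact: cvg_cst | apply: cvgMr_tmp; exact: cvg_id].
    rewrite mul0r addr0 in c.
    exact: cvg_trans (cvg_app _ (@nbhs_dnbhs _ _)) c.
  apply: cvg_trans L; apply: near_eq_cvg; near=> h.
  have h0 : h != 0 by near: h; exact: nbhs_dnbhs_neq.
  rewrite /= (addrC _ x) objD// -scalemxAr !dotZr (dotC (h *: v)) dotZr.
  rewrite (dotC (H *m v)) /GRing.scale /=.
  by field.
by apply: DeriveDef; [apply/cvg_ex; eexists; exact: C | exact: cvg_lim C].
Unshelve. all: by end_near.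
Qed.

Lemma finite_spec H : finite_set (spec H).
Proof.
have p0 : char_poly H != 0 by rewrite monic_neq0// char_poly_monic.
apply: contrapT => /(@infinite_set_fset _ _ (size (char_poly H)))[B BH].
apply/negP; rewrite -ltnNge; apply: max_poly_roots => //; last exact: finmap.fset_uniq.
by apply/allP => l /BH; rewrite /spec /= eigenvalue_root_char.
Qed.

Lemma cap_ortho n (U : 'M[R]_(n, d)) : (U :&: kermx U^T = 0)%MS.
Proof.
apply/eqP; rewrite -submx0; apply/rV_subP => u; rewrite sub_capmx submx0.
case/andP => /submxP[w uE] /sub_kermxP uU; apply/eqP/trmx_inj; rewrite trmx0.
apply: dot_eq0; rewrite /dot trmxK {1}uE -mulmxA.
by rewrite -(trmxK U) -trmx_mul uU trmx0 mulmx0 mxE.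
Qed.

Lemma ortho_full n (U : 'M[R]_(n, d)) v : (v^T <= U + kermx U^T)%MS.
Proof.
apply: submx_full; rewrite /row_full mxrank_disjoint_sum ?cap_ortho//.
by rewrite mxrank_ker mxrank_tr subnKC// rank_leq_col.
Qed.

Lemma eigenprojP H l v : H^T = H ->
  H *m (eigenproj H l *m v) = l *: (eigenproj H l *m v).
Proof.
move=> Hs; apply: trmx_inj; rewrite linearZ /= !trmx_mul trmxK Hs.
by apply/eigenspaceP; exact: proj_mx_sub.
Qed.

Lemma eigenproj_orthogonal H l v w : H^T = H -> H *m w = l *: w ->
  dot w (v - eigenproj H l *m v) = 0.
Proof.
move=> Hs Hw; have : (w^T <= eigenspace H l)%MS.
  by apply/eigenspaceP; rewrite -{1}Hs -trmx_mul Hw linearZ.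
move=> /submxP[u wE]; rewrite /dot wE -mulmxA.
suff /sub_kermxP vP : ((v - eigenproj H l *m v)^T <= kermx (eigenspace H l)^T)%MS.
  by rewrite -[eigenspace H l *m _]trmxK trmx_mul vP trmx0 mulmx0 mxE.
rewrite linearB /= trmx_mul trmxK.
exact/proj_mx_compl_sub/ortho_full.
Qed.

End Facts.

(* Main.v *)
(* The squared spectral components u_k(l) = |P_l g_k|^2 satisfy
   u_{k+1}(l) = (1 - alpha_k l)^2 u_k(l), where alpha_k is a weighted mean of the
   1/l with weights proportional to Psi(l) l u_{k-1}(l). Hence each component
   grows at most by a fixed factor K per step, and as soon as the components
   below l are negligible against u_{k-1}(l), alpha_k l lies in [a/b, 3/2] and
   u(l) contracts. Taking the eigenvalues in increasing order, every component
   becomes, and stays, smaller than any prescribed fraction of |g_0|^2 after a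
   number of steps depending only on Lambda and Psi: the delay of one step only
   costs a factor K^2. In particular |g_{k+N}| <= |g_k| / 2 for a uniform N. *)
Require Import Defs.
From mathcomp Require Import all_boot all_order all_algebra.
From mathcomp Require Import ring lra.
From mathcomp Require Import all_classical all_reals all_analysis.
From mathcomp Require Import complex.
Import Order.TTheory GRing.Theory Num.Theory.
Import numFieldNormedType.Exports.

Local Open Scope classical_set_scope.
Local Open Scope ring_scope.

Set Implicit Arguments.
Unset Strict Implicit.
Unset Printing Implicit Defensive.

(** * Trajectories of the spectral components *)

Lemma ler_sqr_bound (R : realDomainType) (x M : R) : - M <= x <= M ->
  x ^+ 2 <= M ^+ 2.
Proof. by move=> /andP[l u]; rewrite -subr_ge0 subr_sqr mulr_ge0//; lra. Qed.

(** The test is made on [y k] but the contraction acts from [k.+1] to [k.+2]. Below the threshold,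
    two growth steps cost [K ^+ 2]; above it, either branch of the maximum survives a factor
    [c <= 1]. *)
Lemma lagged_decay (R : realFieldType) (y : nat -> R) (K c tau : R) :
    1 <= K -> 0 <= c <= 1 -> 0 <= tau ->
    (forall k, 0 <= y k) ->
    (forall k, y k.+1 <= K * y k) ->
    (forall k, tau < y k -> y k.+2 <= c * y k.+1) ->
  forall k, y k.+1 <= Num.max (c ^+ k * y 1) (K ^+ 2 * tau).
Proof.
move=> K1 /andP[c0 c1] tau0 y0 yK yc; elim=> [|k IHk].
  by rewrite le_max expr0 mul1r lexx.
have [yk|yk] := leP (y k) tau.
  have h1 := yK k; have h2 := yK k.+1.
  rewrite le_max; apply/orP; right.
  apply: le_trans h2 _; rewrite expr2 -mulrA ler_wpM2l//; first lra.
  by apply: le_trans h1 _; rewrite ler_wpM2l//; lra.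
have h := yc _ yk; move: IHk; rewrite !le_max => /orP[ih|ih]; apply/orP.
  left; apply: le_trans h _; rewrite exprS -mulrA.
  exact: ler_wpM2l.
right; apply: le_trans h (le_trans _ ih).
by rewrite -[leRHS]mul1r ler_wpM2r.
Qed.

Lemma expr_small (R : realType) (c e : R) : 0 <= c < 1 -> 0 < e ->
  exists J : nat, forall j, (J <= j)%N -> c ^+ j <= e.
Proof.
move=> /andP[c0 c1] e0.
have /cvgrPdist_le/(_ _ e0)[J _ hJ] : (fun n : nat => c ^+ n) @ \oo --> 0.
  by apply: cvg_expr; rewrite ger0_norm.
exists J => j /hJ /=; rewrite sub0r normrN ger0_norm//.
exact: exprn_ge0.
Qed.

(** The cap at 1 provides a bound for the empty list. *)
Lemma seq_pos_lb (R : realFieldType) (s : seq R) (f : R -> R) :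
  (forall l, l \in s -> 0 < f l) ->
  exists2 m : R, 0 < m <= 1 & forall l, l \in s -> m <= f l.
Proof.
elim: s => [|l s IHs] fs; first by exists 1; rewrite ?lexx ?ltr01.
have [|m /andP[m0 m1] hm] := IHs; first by move=> x xs; apply: fs; rewrite inE xs orbT.
exists (Num.min m (f l)).
  by rewrite lt_min m0 fs ?mem_head//= ge_min m1.
move=> x; rewrite inE ge_min => /orP[/eqP->|/hm->//].
by rewrite lexx orbT.
Qed.

(* [u k l] stands for [|P_l g_k|^2]. Nothing is asked of [al 0], computed from
   the gradient before the start, beyond the bound shared by all steps; this
   makes trajectories stable under time shifts. *)
Record delayed_traj (R : realFieldType) (s : seq R) (w : R -> R) (a : R)
    (u : nat -> R -> R) (al : nat -> R) : Prop := DelayedTraj {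
  dt_ge0 : forall k l, 0 <= u k l;
  dt_rec : forall k l, l \in s -> u k.+1 l = (1 - al k * l) ^+ 2 * u k l;
  dt_start : 0 <= al 0 <= a^-1;
  dt_step : forall k, al k.+1 =
    (\sum_(l <- s) w l * u k l) / (\sum_(l <- s) w l * l * u k l) }.

Section Trajectory.
Variables (R : realType) (s : seq R) (w : R -> R) (a b : R).
Hypotheses (a_gt0 : 0 < a) (le_ab : a <= b).
Hypothesis s_bounds : forall l, l \in s -> a <= l <= b.
Hypothesis w_gt0 : forall l, l \in s -> 0 < w l.

Let K := (b / a) ^+ 2.
Let total (u : nat -> R -> R) k := \sum_(l <- s) u k l.

Let ba1 : 1 <= b / a. Proof. by rewrite ler_pdivlMr// mul1r. Qed.
Let K1 : 1 <= K. Proof. exact: exprn_ege1. Qed.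
Let b_gt0 : 0 < b. Proof. exact: lt_le_trans le_ab. Qed.

(* The lower bound is 0 rather than 1/b because of 0 / 0 = 0 when [u] vanishes on [s]. *)
Lemma rayleigh_bounds (u : R -> R) : (forall l, 0 <= u l) ->
  0 <= (\sum_(l <- s) w l * u l) / (\sum_(l <- s) w l * l * u l) <= a^-1.
Proof.
move=> u0.
have D0 : 0 <= \sum_(l <- s) w l * l * u l.
  rewrite big_seq sumr_ge0// => l ls.
  have /andP[al_ _] := s_bounds ls.
  rewrite mulr_ge0// mulr_ge0//; first exact/ltW/w_gt0.
  exact: le_trans (ltW a_gt0) al_.
have N0 : 0 <= \sum_(l <- s) w l * u l.
  rewrite big_seq sumr_ge0// => l ls.
  by rewrite mulr_ge0// ltW ?w_gt0.
rewrite divr_ge0//=.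
move: D0; rewrite le_eqVlt => /predU1P[<-|D0].
  by rewrite invr0 mulr0 invr_ge0 ltW.
rewrite ler_pdivrMr// -ler_pdivrMl ?invr_gt0// invrK mulr_sumr.
rewrite !big_seq ler_sum// => l ls.
rewrite mulrA ler_wpM2r// mulrC ler_wpM2l//.
  exact/ltW/w_gt0.
by have /andP[] := s_bounds ls.
Qed.

Lemma dt_al_bounds u al k : delayed_traj s w a u al -> 0 <= al k <= a^-1.
Proof.
move=> T; case: k => [|k]; first exact: dt_start T.
by rewrite (dt_step T) rayleigh_bounds//; exact: dt_ge0 T _.
Qed.

Lemma dt_shift u al n : delayed_traj s w a u al ->
  delayed_traj s w a (fun k => u (k + n)%N) (fun k => al (k + n)%N).
Proof.
move=> T; split=> [k l|k l ls||k].
- exact: (dt_ge0 T).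
- exact: (dt_rec T).
- exact: (dt_al_bounds n T).
- exact: (dt_step T).
Qed.

(** Here [al k * l] lies in [[0, b / a]] and [b / a >= 1], so [|1 - al k * l| <= b / a]. *)
Lemma dt_growth u al k l : delayed_traj s w a u al -> l \in s ->
  u k.+1 l <= K * u k l.
Proof.
move=> T ls; rewrite (dt_rec T)// ler_wpM2r ?(dt_ge0 T)//.
have /andP[al0 ala] := dt_al_bounds k T; have /andP[al_ lb] := s_bounds ls.
have l0 : 0 <= l by apply: le_trans al_; exact: ltW.
have h : al k * l <= b / a.
  by rewrite mulrC; apply: ler_pM.
have h0 : 0 <= al k * l by rewrite mulr_ge0.
by apply: ler_sqr_bound; have := ba1; lra.
Qed.

Lemma dt_growth_iter u al k l : delayed_traj s w a u al -> l \in s ->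
  u k l <= K ^+ k * u 0 l.
Proof.
move=> T ls; elim: k => [|k IHk]; first by rewrite mul1r.
apply: le_trans (dt_growth k T ls) _; rewrite exprS -mulrA ler_wpM2l//.
by apply: le_trans K1.
Qed.

Let total_ge0 u al k : delayed_traj s w a u al -> 0 <= total u k.
Proof. by move=> T; apply: sumr_ge0 => l _; exact: (dt_ge0 T). Qed.

Let le_total u al k l : delayed_traj s w a u al -> l \in s -> u k l <= total u k.
Proof.
move=> T ls; rewrite /total (big_rem l)//= lerDl.
by apply: sumr_ge0 => i _; exact: (dt_ge0 T).
Qed.

Let c := (Num.max 2^-1 (1 - a / b)) ^+ 2.
Let c_bounds : 0 <= c < 1.
Proof.
rewrite exprn_ge0/= ?le_max ?invr_ge0 ?ler0n//.
rewrite expr_lt1 ?le_max ?invr_ge0 ?ler0n//.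
rewrite gt_max gtrBl divr_gt0// andbT.
lra.
Qed.

(** Induction on this number visits the components in increasing order without sorting [s]. *)
Let rank l := count (fun m => m < l) s.

(* Components below [l] weighing at most half of what the others do force the
   step size below [3 / (2 l)], so that [|1 - al l| <= max (1/2, 1 - a/b)]. *)
Lemma dt_contract u al k l : delayed_traj s w a u al -> l \in s ->
  0 < u k l ->
  \sum_(m <- s | m < l) w m * u k m <= w l * u k l / 2 ->
  u k.+2 l <= c * u k.+1 l.
Proof.
move=> T ls u0 small; rewrite (dt_rec T)// ler_wpM2r ?(dt_ge0 T)//.
have /andP[al_ lb] := s_bounds ls.
have l0 : 0 < l by apply: lt_le_trans al_.
set N := \sum_(m <- s) w m * u k m.
set D := \sum_(m <- s) w m * m * u k m.
set L := \sum_(m <- s | m < l) w m * u k m in small.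
set U := \sum_(m <- s | ~~ (m < l)) w m * u k m.
have NE : N = L + U by rewrite /N (bigID (fun m => m < l)).
have pos m : m \in s -> 0 <= w m * u k m.
  by move=> ms; rewrite mulr_ge0 ?(dt_ge0 T)// ltW ?w_gt0.
have UD : l * U <= D.
  rewrite /D (bigID (fun m => m < l))/= ler_wpDl//.
    rewrite big_seq_cond sumr_ge0// => m /andP[ms _].
    rewrite mulrAC mulr_ge0 ?pos//; apply: (le_trans (ltW a_gt0)).
    by have /andP[] := s_bounds ms.
  rewrite /U mulr_sumr !(big_seq_cond (fun m => ~~ _)) ler_sum// => m.
  rewrite -leNgt => /andP[ms lm].
  by rewrite mulrAC mulrC ler_wpM2l ?pos.
have lU : w l * u k l <= U.
  rewrite /U (big_rem l)//= ltxx/= lerDl big_seq_cond sumr_ge0// => m /andP[ms _].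
  by apply: pos; exact: mem_rem ms.
have wu : 0 < w l * u k l by rewrite mulr_gt0 ?w_gt0.
have L0 : 0 <= L by rewrite /L big_seq_cond sumr_ge0// => m /andP[ms _]; exact: pos.
have U0 : 0 < U by lra.
have D0 : 0 < D by apply: lt_le_trans UD; rewrite mulr_gt0.
have DN : D <= b * N.
  rewrite /N /D mulr_sumr !big_seq ler_sum// => m ms.
  rewrite mulrAC mulrC ler_wpM2r ?pos//.
  by have /andP[] := s_bounds ms.
have alE : al k.+1 = N / D by rewrite (dt_step T).
(* By [small] and [lU], [L <= U / 2]; hence [N <= 3/2 * U], while [D >= l * U]. *)
have hi : al k.+1 * l <= 3 / 2.
  rewrite alE mulrAC ler_pdivrMr// NE.
  have : l * (L + U) <= l * (3/2 * U) by rewrite ler_wpM2l//; lra.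
  by lra.
have lo : a / b <= al k.+1 * l.
  rewrite alE mulrC ler_pM ?(ltW a_gt0) ?invr_ge0 ?(ltW b_gt0)//.
  by rewrite ler_pdivlMr// ler_pdivrMl.
have m1 : 2^-1 <= Num.max 2^-1 (1 - a / b) by rewrite le_max lexx.
have m2 : 1 - a / b <= Num.max 2^-1 (1 - a / b) by rewrite le_max lexx orbT.
by apply: ler_sqr_bound; lra.
Qed.

(* The components are controlled in increasing order of [l]: once all lower ones
   are negligible, [u l] decays whenever it exceeds a threshold. *)
Lemma dt_small n (e : R) : 0 < e -> exists N : nat, forall u al,
  delayed_traj s w a u al -> forall l, l \in s -> (rank l < n)%N ->
  forall k, (N <= k)%N -> u k l <= e * total u 0.
Proof.
elim: n e => [|n IHn] e e0; first by exists 0.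
have [wm /andP[wm0 wm1] wmP] := seq_pos_lb w_gt0.
set W := 1 + \sum_(l <- s) w l.
have sw0 : 0 <= \sum_(l <- s) w l.
  by rewrite big_seq sumr_ge0// => l ls; rewrite ltW ?w_gt0.
have W1 : 1 <= W by rewrite lerDl.
have W0 : 0 < W by lra.
have K0 : 0 < K by apply: lt_le_trans K1.
(* Makes the second branch of [lagged_decay] equal to the target [e * S]. *)
set tau := e / K ^+ 2.
have tau0 : 0 < tau by rewrite divr_gt0// exprn_gt0.
(* With total weight at most [W], lower components of size [e' * S] weigh at most
   [wm * tau * S / 2], which [dt_contract] tolerates once [u l] exceeds [tau * S]. *)
set e' := tau * wm / (2 * W).
have e'0 : 0 < e' by apply: divr_gt0; apply: mulr_gt0.
have [N hN] := IHn _ e'0.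
have [J hJ] := @expr_small _ c (e / K ^+ N.+1) c_bounds (divr_gt0 e0 (exprn_gt0 _ K0)).
(* After [N] steps the lower components are negligible, one more step is the lag of [lagged_decay],
   and [J] steps undo the growth by at most [K ^+ N.+1] accumulated meanwhile. *)
exists (J + N.+1)%N => u al T l ls rl k.
have S0 : 0 <= total u 0 by exact: (total_ge0 _ T).
set S := total u 0 in S0 *.
move=> /subnKC <-; set j := (k - _)%N.
have -> : (J + N.+1 + j = (J + j).+1 + N)%N by rewrite addnAC addnS addSn.
have decay := @lagged_decay _ (fun i => u (i + N)%N l) K c (tau * S) K1 _ _ _ _ _ (J + j).
apply: le_trans (decay _ _ _ _ _) _.
- by have /andP[-> /ltW] := c_bounds.
- by rewrite mulr_ge0// ltW.
- by move=> i; exact: (dt_ge0 T).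
- by move=> i; exact: (dt_growth _ T ls).
- move=> i big; apply: (dt_contract T ls).
    by apply: le_lt_trans big; rewrite mulr_ge0// ltW.
  have -> : \sum_(m <- s | m < l) w m * u (i + N)%N m
     = \sum_(m <- s | (m \in s) && (m < l)) w m * u (i + N)%N m by rewrite big_seq_cond.
  apply: (@le_trans _ _ (\sum_(m <- s | (m \in s) && (m < l)) w m * (e' * S))).
    apply: ler_sum => m /andP[ms ml]; rewrite ler_wpM2l ?(ltW (w_gt0 ms))//.
    apply: (hN _ _ T _ ms); last exact: leq_addl.
    rewrite ltnS in rl; apply: leq_trans rl.
    (* The entry [m] is below [l] but not below itself, so its rank is strictly smaller. *)
    apply: (@leq_trans (count (fun x => x < m) s + count_mem m s)).
      by rewrite -addn1 leq_add2l -has_count has_pred1.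
    rewrite -count_predUI [X in (_ + X <= _)%N](@eq_count _ _ pred0) => [|x /=]; last first.
      by apply/negP => /andP[xm /eqP xE]; rewrite xE ltxx in xm.
    rewrite count_pred0 addn0; apply: sub_count => x /= /orP[xm|/eqP->//].
    exact: lt_trans ml.
  rewrite -big_seq_cond -mulr_suml.
  have hw : \sum_(m <- s | m < l) w m <= W.
    rewrite /W [in leRHS](bigID (fun m => m < l))/= addrCA lerDl addr_ge0//.
    by rewrite big_seq_cond sumr_ge0// => m /andP[/w_gt0/ltW].
  apply: (@le_trans _ _ (W * (e' * S))).
    by rewrite ler_wpM2r// mulr_ge0// ltW.
  have -> : W * (e' * S) = wm * (tau * S) / 2 by rewrite /e'; field; rewrite gt_eqF.
  rewrite ler_pM2r ?invr_gt0//.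
  apply: ler_pM; [exact: ltW | by rewrite mulr_ge0// ltW | exact: wmP | exact: ltW].
- rewrite ge_max; apply/andP; split; last first.
    by rewrite mulrA /tau mulrCA mulfV ?mulr1// expf_neq0// gt_eqF.
  apply: (@le_trans _ _ (e / K ^+ N.+1 * (K ^+ N.+1 * S))).
    apply: ler_pM; rewrite ?(dt_ge0 T)//.
    - by apply: exprn_ge0; have /andP[] := c_bounds.
    - by apply: hJ; rewrite leq_addr.
    - apply: le_trans (dt_growth_iter _ T ls) _; rewrite add1n ler_wpM2l ?(exprn_ge0 _ (ltW K0))//.
      exact: (le_total _ T ls).
  by rewrite mulrA divfK// expf_neq0// gt_eqF.
Qed.

Lemma dt_total_small (e : R) : 0 < e -> exists N : nat, forall u al,
  delayed_traj s w a u al ->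
  forall k, (N <= k)%N -> total u k <= e * total u 0.
Proof.
move=> e0; have n0 : 0 < (size s).+1%:R :> R by [].
(* [(size s).+1] exceeds every rank, and stays a valid divisor when [s] is empty. *)
have [N hN] := dt_small (size s).+1 (divr_gt0 e0 n0).
exists N => u al T k Nk; rewrite {1}/total big_seq.
apply: (@le_trans _ _ (\sum_(l <- s) e / (size s).+1%:R * total u 0)).
  rewrite [leRHS]big_seq; apply: ler_sum => l ls; apply: (hN _ _ T) => //.
  by rewrite ltnS count_size.
rewrite big_const_seq count_predT iter_addr_0 -mulrnAl ler_wpM2r ?(total_ge0 _ T)//.
by rewrite -mulr_natr mulrAC ler_pdivrMr// ler_wpM2l ?(ltW e0)// ler_nat.
Qed.

Lemma dt_rlinear : exists M rho : R, [/\ 0 <= M, 0 < rho < 1 &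
  forall u al, delayed_traj s w a u al ->
  forall k, total u k <= M * (rho ^+ k) ^+ 2 * total u 0].
Proof.
have [|N hN] := @dt_total_small 4^-1; first by rewrite invr_gt0.
(* Since [n * (1 - rho) = 1/2], Bernoulli's inequality [bern] yields [rho ^+ n >= 1/2]; a drop of
   the total by the factor 1/4 over [n] steps is then covered by [(rho ^+ n) ^+ 2]. *)
pose n := N.+1; pose rho : R := 1 - (2 * n%:R)^-1.
have n1 : 1 <= n%:R :> R by rewrite ler1n.
have rho_lt : (2 * n%:R)^-1 <= 2^-1 :> R.
  by rewrite lef_pV2 ?posrE//; lra.
have rho_gt : 0 < (2 * n%:R)^-1 :> R by rewrite invr_gt0; lra.
have rho01 : 0 < rho < 1 by rewrite /rho; lra.
have /andP[rho0 rho1] := rho01.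
have bern k : 1 - k%:R * (1 - rho) <= rho ^+ k.
  elim: k => [|k IHk]; first by rewrite mul0r subr0.
  have k0 : 0 <= k%:R :> R by [].
  rewrite exprS; apply: le_trans (ler_wpM2l (ltW rho0) IHk).
  rewrite -natr1 -subr_ge0.
  have -> : rho * (1 - k%:R * (1 - rho)) - (1 - (k%:R + 1) * (1 - rho))
      = k%:R * (1 - rho) ^+ 2 by ring.
  by rewrite mulr_ge0// sqr_ge0.
have rhon : 2^-1 <= rho ^+ n.
  apply: le_trans (bern n); rewrite /rho opprB addrCA subrr addr0 invfM mulrCA.
  by rewrite mulfV ?mulr1; [lra | rewrite gt_eqF//; lra].
have K0 : 0 <= K by apply: le_trans K1.
exists (4 * K ^+ n), rho; split=> //; first by rewrite mulr_ge0// (exprn_ge0 _ K0).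
move=> u al T k; elim/ltn_ind: k u al T => k IHk u al T.
have S0 := total_ge0 0%N T.
(* Before time [n] the growth bound suffices, the factor 4 offsetting [(rho ^+ k) ^+ 2 >= 1/4];
   later times reduce to the trajectory restarted at [n]. *)
have [kn|nk] := ltnP k n.
  apply: (@le_trans _ _ (K ^+ n * total u 0)).
    rewrite /total mulr_sumr !big_seq; apply: ler_sum => l ls.
    apply: le_trans (dt_growth_iter k T ls) _; rewrite ler_wpM2r ?(dt_ge0 T)//.
    by rewrite ler_weXn2l// ltnW.
  rewrite ler_wpM2r// -mulrA mulrCA ler_peMr ?(exprn_ge0 _ K0)//.
  have : 2^-1 <= rho ^+ k.
    by apply: le_trans rhon _; rewrite ler_wiXn2l ?(ltW rho0) ?(ltW rho1)// ltnW.
  by rewrite expr2; nra.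
have := IHk (k - n)%N _ _ _ (dt_shift n T). rewrite /total !subnK// add0n.
move=> /(_ _)/le_trans; apply; first by rewrite ltn_subrL (leq_trans _ nk).
have h : total u n <= (rho ^+ n) ^+ 2 * total u 0.
  apply: le_trans (hN _ _ T _ (leqnSn _)) _; rewrite ler_wpM2r//.
  by rewrite expr2; nra.
apply: le_trans (ler_wpM2l _ h) _; first by rewrite mulr_ge0 ?sqr_ge0// mulr_ge0// (exprn_ge0 _ K0).
by rewrite mulrA -[_ * _ * (rho ^+ n) ^+ 2]mulrA -exprMn -exprD subnK.
Qed.

End Trajectory.

(** * Spectral decomposition of a symmetric matrix *)

Section Symmetric.
Variables (R : realType) (d : nat) (H : 'M[R]_d).
Hypothesis Hsym : H^T = H.
Implicit Types (v w z : 'cV[R]_d) (s : seq R).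

Lemma dot_sym v w : dot (H *m v) w = dot v (H *m w).
Proof. by rewrite /dot trmx_mul Hsym mulmxA. Qed.

Lemma dotBr v w z : dot v (w - z) = dot v w - dot v z.
Proof. by rewrite dotDr -scaleN1r dotZr mulN1r. Qed.

Lemma dot_sumr v s (F : R -> 'cV[R]_d) :
  dot v (\sum_(l <- s) F l) = \sum_(l <- s) dot v (F l).
Proof. by rewrite /dot mulmx_sumr summxE. Qed.

Lemma dot_ge0 v : 0 <= dot v v.
Proof. by rewrite /dot mxE sumr_ge0// => i _; rewrite mxE -expr2 sqr_ge0. Qed.

Lemma eigen_orthogonal (l m : R) v w :
  H *m v = l *: v -> H *m w = m *: w -> l != m -> dot v w = 0.
Proof.
move=> Hv Hw lm; have := dot_sym v w.
rewrite Hv Hw dotZr dotC dotZr (dotC w) => /eqP.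
by rewrite -subr_eq0 -mulrBl mulf_eq0 subr_eq0 (negPf lm) => /eqP.
Qed.

(** The difference of the two candidates lies in the eigenspace and is orthogonal to it, hence to
    itself. *)
Lemma eigenproj_unique l v z : H *m z = l *: z ->
  (forall w, H *m w = l *: w -> dot w (v - z) = 0) -> eigenproj H l *m v = z.
Proof.
move=> Hz zP; apply/eqP; rewrite -subr_eq0; apply/eqP/dot_eq0.
set y := (X in dot X X).
have Hy : H *m y = l *: y by rewrite mulmxBr eigenprojP// Hz scalerBr.
have -> : dot y y = dot y ((v - z) - (v - eigenproj H l *m v)).
  by congr dot; rewrite opprB addrC addrA subrK.
by rewrite dotBr zP// eigenproj_orthogonal// subrr.
Qed.

Lemma eigenproj_comm l v : eigenproj H l *m (H *m v) = l *: (eigenproj H l *m v).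
Proof.
apply: eigenproj_unique => [|w Hw]; first by rewrite -scalemxAr eigenprojP.
rewrite dotBr -dot_sym Hw dotZr dotC dotZr -mulrBr (dotC v) -dotBr.
by rewrite eigenproj_orthogonal// mulr0.
Qed.

Lemma dot_eigenproj l v :
  dot v (eigenproj H l *m v) = dot (eigenproj H l *m v) (eigenproj H l *m v).
Proof.
rewrite dotC; apply/eqP; rewrite -subr_eq0 -dotBr.
by rewrite eigenproj_orthogonal// eigenprojP.
Qed.

(* Over R[i], H is diagonalizable with real eigenvalues [rs], hence annihilated
   by the product of the [H - r]. *)
Lemma sym_annihilator : exists rs : seq R, forall v,
  foldr (fun r z => H *m z - r *: z) v rs = 0.
Proof.
pose C := (R[i])%C; pose f := complex.real_complex R.
pose A : 'M[C]_d := map_mx f H.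
have AR : A \is a mxOver Num.real.
  by apply/mxOverP => i j; rewrite mxE; apply/complex.complex_realP; exists (H i j).
have Aherm : A \is hermsymmx.
  apply: realsym_hermsym => //; apply/is_hermitianmxP.
  by rewrite expr0 scale1r map_mx_id// /A map_trmx Hsym.
have /orthomx_spectralP AE := hermitian_normalmx Aherm.
have /mxOverP DR := hermitian_spectral_diag_real Aherm.
set P := spectralmx A in AE; set D := spectral_diag A in AE DR.
have PA : P *m A = diag_mx D *m P.
  by rewrite {1}AE !mulmxA mulmxV ?spectral_unit// mul1mx.
exists [seq complex.Re (D 0 i) | i <- enum 'I_d] => v.
apply: (@map_mx_inj _ _ f); rewrite map_mx0.
set rs := [seq _ | _ <- _]; set z := foldr _ _ _.
suff Pz : P *m map_mx f z = 0.
  by rewrite -[map_mx f z](mulKmx (spectral_unit A)) -/P Pz mulmx0.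
(* In the spectral basis each factor [H - r] scales coordinate [i] by [D 0 i - r], and [r = D 0 i]
   occurs in [rs]. *)
have fold_coord i : forall l, (P *m map_mx f (foldr (fun r z => H *m z - r *: z) v l)) i 0
    = (\prod_(r <- l) (D 0 i - f r)) * (P *m map_mx f v) i 0.
  elim=> [|r l IH]; first by rewrite big_nil mul1r.
  rewrite /= map_mxB map_mxM map_mxZ mulmxBr mulmxA PA -mulmxA -scalemxAr.
  rewrite big_cons -mulrA -IH mulrBl -/f.
  by rewrite mxE mul_diag_mx mxE [in X in _ + X]mxE [in X in _ + X]mxE.
apply/colP => i; rewrite fold_coord mxE.
have : complex.Re (D 0 i) \in rs by apply: map_f; rewrite mem_enum.
by move=> /(big_rem _)->; rewrite /f/= complex.RRe_real ?DR// subrr !mul0r mxE.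
Qed.

(** Annihilating factors are peeled off one at a time: what remains under the outermost one
    satisfies the eigenvector equation, yet inherits from [w] orthogonality to all eigenvectors, so
    it is 0. *)
Lemma eigen_complete w :
  (forall l z, H *m z = l *: z -> dot z w = 0) -> w = 0.
Proof.
have [rs rsP] := sym_annihilator; move: (rsP w).
elim: rs {rsP} => [//|r rs IH] /= ann wP; apply: IH => //.
set y := foldr _ _ _ in ann *.
have Hy : H *m y = r *: y by apply/eqP; rewrite -subr_eq0 ann.
apply: dot_eq0; suff /(_ rs) yP : forall t l z, H *m z = l *: z ->
    dot z (foldr (fun r z => H *m z - r *: z) w t) = 0 by exact: yP Hy.
elim=> [|r' t IHt] l z Hz /=; first exact: wP Hz.
by rewrite dotBr -dot_sym Hz (dotC (l *: z)) !dotZr (dotC _ z) (IHt l)// !mulr0 subrr.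
Qed.

(** An inclusion of the active set in [s], not an equality, so that it survives a step that kills a
    component. *)
Definition supported v s := forall l, spec H l -> l \notin s -> eigenproj H l *m v = 0.

Lemma eigen_notin v s l z : supported v s -> H *m z = l *: z -> l \notin s ->
  dot z v = 0.
Proof.
move=> vs Hz ls; have [->|z0] := eqVneq z 0; first by rewrite /dot trmx0 mul0mx mxE.
have sl : spec H l.
  apply/eigenvalueP; exists z^T; first by rewrite -{1}Hsym -trmx_mul Hz linearZ.
  by rewrite -(inj_eq trmx_inj) trmxK trmx0.
by have := eigenproj_orthogonal v Hsym Hz; rewrite vs// subr0.
Qed.

(** The residual is orthogonal to every eigenvector: for [l] in [s] only the projection at [l]
    contributes, and for other [l] each term vanishes. *)
Lemma eigen_decomp v s : uniq s -> supported v s ->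
  v = \sum_(l <- s) eigenproj H l *m v.
Proof.
move=> us vs; apply/eqP; rewrite -subr_eq0; apply/eqP/eigen_complete => l z Hz.
rewrite dotBr dot_sumr.
have ort m : m != l -> dot z (eigenproj H m *m v) = 0.
  move=> ml; apply: eigen_orthogonal Hz (eigenprojP m v Hsym) _.
  by rewrite eq_sym.
have [ls|ls] := boolP (l \in s).
  rewrite (bigD1_seq l)//= big1 => [|m /ort//].
  by rewrite addr0 -dotBr eigenproj_orthogonal.
rewrite (eigen_notin vs Hz ls) big_seq big1 ?subrr// => m ms.
by apply: ort; apply: contraNneq ls => <-.
Qed.

Definition energy v l : R := dot (eigenproj H l *m v) (eigenproj H l *m v).

Lemma dot_energy v s : uniq s -> supported v s ->
  dot v v = \sum_(l <- s) energy v l.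
Proof.
move=> us vs; rewrite {2}(eigen_decomp us vs) dot_sumr.
by apply: eq_bigr => l _; rewrite dot_eigenproj.
Qed.

Lemma mulmx_energy v s : uniq s -> supported v s ->
  H *m v = \sum_(l <- s) l *: (eigenproj H l *m v).
Proof.
move=> us vs; rewrite {1}(eigen_decomp us vs) mulmx_sumr.
by apply: eq_bigr => l _; rewrite eigenprojP.
Qed.

Lemma energy_step (al : R) v l :
  energy (v - al *: (H *m v)) l = (1 - al * l) ^+ 2 * energy v l.
Proof.
rewrite /energy mulmxBr -scalemxAr eigenproj_comm scalerA -[X in X - _]scale1r -scalerBl.
by rewrite dotZr dotC dotZr mulrA expr2.
Qed.

Lemma supported_step (al : R) v s : supported v s ->
  supported (v - al *: (H *m v)) s.
Proof.
move=> vs l sl ls.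
by rewrite mulmxBr -scalemxAr eigenproj_comm (vs l) // !scaler0 subr0.
Qed.

Lemma dot_spectral_fun Psi v z s : uniq s -> {in s, forall l, spec H l} ->
  supported z s ->
  dot v (spectral_fun Psi H *m z) = \sum_(l <- s) Psi l * dot v (eigenproj H l *m z).
Proof.
move=> us ss zs; rewrite /spectral_fun fsbig_finite ?mulmx_suml; last exact: finite_spec.
rewrite dot_sumr -fsbig_finite; last exact: finite_spec.
rewrite (@fsbigE _ _ _ _ _ s)//= => [|l sl ls].
  rewrite big_seq_cond [RHS]big_seq; apply: eq_big => l; last by rewrite -scalemxAl dotZr.
  by case: (boolP (l \in s)) => //= /ss sl; rewrite mem_set.
by rewrite -scalemxAl zs// scaler0 /dot mulmx0 mxE.
Qed.

Lemma rayleigh_energy Psi v s : uniq s -> {in s, forall l, spec H l} ->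
  supported v s -> rayleigh_step Psi H v =
  (\sum_(l <- s) Psi l * energy v l) / (\sum_(l <- s) Psi l * l * energy v l).
Proof.
move=> us ss vs; rewrite /rayleigh_step -mulmxA !(dot_spectral_fun _ _ us)//; last first.
  by move=> l sl ls; rewrite eigenproj_comm vs// scaler0.
congr (_ / _); apply: eq_bigr => l _.
  by rewrite dot_eigenproj.
by rewrite eigenproj_comm dotZr dot_eigenproj mulrA.
Qed.

(** BB2 is the weighted rule with weight [id]. *)
Lemma bb2_energy v s : uniq s -> supported v s -> bb2_step H v =
  (\sum_(l <- s) l * energy v l) / (\sum_(l <- s) l * l * energy v l).
Proof.
move=> us vs; rewrite /bb2_step expr2 -[H * H *m v]mulmxA (mulmx_energy us vs).
rewrite mulmx_sumr !dot_sumr.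
congr (_ / _); apply: eq_bigr => l _; first by rewrite dotZr dot_eigenproj.
by rewrite -scalemxAr eigenprojP// !dotZr dot_eigenproj mulrA.
Qed.

End Symmetric.

(** * Convergence *)

Lemma spd_eigenvalue_gt0 (R : realType) (d : nat) (H : 'M[R]_d) (l : R) :
  spd H -> spec H l -> 0 < l.
Proof.
move=> [Hs Hp] /eigenvalueP[z Hz z0].
have zt0 : z^T != 0 by rewrite -(inj_eq trmx_inj) trmxK trmx0.
have := Hp _ zt0; have -> : H *m z^T = l *: z^T by rewrite -{1}Hs -trmx_mul Hz linearZ.
by rewrite dotZr pmulr_lgt0// lt_neqAle dot_ge0 andbT eq_sym; apply: contraNneq zt0 => /dot_eq0/eqP.
Qed.

Lemma grad_step (R : realType) (d : nat) (H : 'M[R]_d) (q x : 'cV[R]_d) (al : R) :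
  grad H q (x - al *: grad H q x) = grad H q x - al *: (H *m grad H q x).
Proof. by rewrite {1}/grad addrAC mulmxBr -scalemxAr. Qed.

Lemma enorm_le (R : realType) (d : nat) (v : 'cV[R]_d) (y : R) : 0 <= y ->
  dot v v <= y ^+ 2 -> enorm v <= y.
Proof. by move=> y0 /ler_wsqrtr; rewrite sqrtr_sqr ger0_norm. Qed.

Lemma sqr_enorm (R : realType) (d : nat) (v : 'cV[R]_d) : enorm v ^+ 2 = dot v v.
Proof. by rewrite sqr_sqrtr// dot_ge0. Qed.

(** Eigenvalues are nonzero, so [e] is supported where [H *m e] is, and each energy gets multiplied
    by [l ^+ 2 >= a ^+ 2]. *)
Lemma dot_error_le (R : realType) (d : nat) (H : 'M[R]_d) (s : seq R) (a : R)
    (e : 'cV[R]_d) : spd H -> 0 < a -> uniq s -> (forall l, l \in s -> a <= l) ->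
  supported H (H *m e) s -> a ^+ 2 * dot e e <= dot (H *m e) (H *m e).
Proof.
move=> sH a0 us sa gs; have Hs := sH.1.
have es : supported H e s.
  move=> l sl ls; apply/eqP; have := gs l sl ls; rewrite eigenproj_comm// => /eqP.
  by rewrite scaler_eq0 gt_eqF ?(spd_eigenvalue_gt0 sH).
rewrite (dot_energy Hs us es) (dot_energy Hs us gs) mulr_sumr !big_seq.
apply: ler_sum => l /sa al; rewrite /energy eigenproj_comm// dotZr dotC dotZr mulrA -expr2.
by rewrite ler_wpM2r ?dot_ge0// lerXn2r ?nnegrE ?(ltW a0)//; exact: le_trans (ltW a0) al.
Qed.

(** The gap is half of [dot e (H *m e)], which is bounded by expanding [|e - H e|^2 >= 0]. *)
Lemma gap_le (R : realType) (d : nat) (H : 'M[R]_d) (q e : 'cV[R]_d) : spd H ->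
  obj H q (xstar H q + e) - obj H q (xstar H q)
    <= dot e e + dot (H *m e) (H *m e).
Proof.
move=> sH; rewrite objD// /grad subrr mulmx0 {1}/dot trmx0 mul0mx mxE addr0 addrAC subrr add0r.
have := dot_ge0 (e - H *m e).
rewrite dotBr (dotC _ e) (dotC _ (H *m e)) !dotBr (dotC _ e).
have := dot_ge0 e; have := dot_ge0 (H *m e); lra.
Qed.

(** Common to both rules, which enter only through their energy form. [step] ranges over all
    dimensions because the constants are chosen before [d]; the premise [0 < l] lets [w] be [id]. *)
Lemma tail_rlinear (R : realType) (Lam : set R) (w : R -> R)
    (step : forall d, 'M[R]_d -> 'cV[R]_d -> R) :
  finite_set Lam -> (forall l, Lam l -> 0 < l -> 0 < w l) ->
  (forall d (H : 'M[R]_d) v s, spd H -> uniq s -> {in s, forall l, spec H l} ->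
     supported H v s -> step d H v =
     (\sum_(l <- s) w l * energy H v l) / (\sum_(l <- s) w l * l * energy H v l)) ->
  exists C rho : R, 0 < rho < 1 /\
    forall (d : nat) (H : 'M[R]_d) (q : 'cV[R]_d) (x : int -> 'cV[R]_d),
      spd H ->
      post_warm_up_tail H q Lam (step d H) x ->
      [/\ forall k : nat,
            enorm (grad H q (x k%:Z)) <= C * rho ^+ k * enorm (grad H q (x 0)),
          exists C' : R, forall k : nat,
            enorm (x k%:Z - xstar H q) <= C' * rho ^+ k &
          exists C'' : R, forall k : nat,
            obj H q (x k%:Z) - obj H q (xstar H q) <= C'' * rho ^+ (2 * k)].
Proof.
move=> finL w_gt0 stepE.
(* If [Lam] has a nonpositive element it is not the active set of any positive definite matrix, and
   any constants do. *)
have [Lpos|Lneg] := pselect (forall l, Lam l -> 0 < l); last first.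
  exists 0, 2^-1; split=> [|d H q x sH [_ act _ _ _]]; first lra.
  exfalso; apply: Lneg => l; rewrite -act => -[sl _].
  exact: spd_eigenvalue_gt0 sl.
pose s : seq R := finmap.enum_fset (fset_set Lam).
have us : uniq s by exact: finmap.fset_uniq.
have sE l : (l \in s) = (l \in Lam) := in_fset_set finL l.
have sL l : l \in s -> Lam l by rewrite sE inE.
have Ls l : Lam l -> l \in s by rewrite sE inE.
have s_gt0 l : l \in s -> 0 < l by move=> /sL/Lpos.
(* Bounds read off from [Lam] alone, not its extremes; [a <= 1 <= b] gives [a <= b]. *)
have [a /andP[a0 a1] sa] := seq_pos_lb s_gt0.
pose b := 1 + \sum_(l <- s) l.
have s_ge0 : 0 <= \sum_(l <- s) l by rewrite big_seq sumr_ge0// => l /s_gt0/ltW.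
have ab : a <= b by apply: le_trans a1 _; rewrite lerDl.
have sab l : l \in s -> a <= l <= b.
  move=> ls; rewrite sa//= /b (big_rem l)//= addrCA lerDl addr_ge0//.
  by rewrite big_seq sumr_ge0// => m /mem_rem/s_gt0/ltW.
have ws l : l \in s -> 0 < w l by move=> ls; apply: w_gt0; [exact: sL|exact: s_gt0].
have [M [rho [M0 rho01 decay]]] := dt_rlinear a0 ab sab ws.
have /andP[rho0 rho1] := rho01.
exists (Num.sqrt M), rho; split=> // d H q x sH [[ah warm] act _ _ xstep].
have Hs := sH.1.
have ss : {in s, forall l, spec H l} by move=> l /sL; rewrite -act => -[].
pose g (j : int) := grad H q (x j).
have gm1 : supported H (g (-1)) s.
  move=> l sl ls; apply/eqP; apply: contraNT ls => pl; apply: Ls.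
  by rewrite -act; split.
have g0 : supported H (g 0) s by rewrite /g warm grad_step; exact: supported_step.
have kS (k : nat) : k.+1%:Z = k%:Z + 1 by rewrite -addn1 PoszD.
have gS (k : nat) : g k.+1 = g k - step d H (g (k%:Z - 1)) *: (H *m g k).
  by rewrite /g -grad_step -xstep kS.
have gk (k : nat) : supported H (g k) s.
  by elim: k => // k IHk; rewrite gS; exact: supported_step.
have gp (k : nat) : supported H (g (k%:Z - 1)) s.
  by case: k => // k; rewrite kS addrK.
(* The first step size comes from [g (-1)], outside the trajectory; [rayleigh_bounds] applied there
   supplies [dt_start]. *)
have T : delayed_traj s w a (fun k l => energy H (g k%:Z) l)
    (fun k => step d H (g (k%:Z - 1))).
  split=> [k l|k l ls||k].
  - exact: dot_ge0.
  - by rewrite gS energy_step.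
  - rewrite (stepE _ _ _ s)//; apply: rayleigh_bounds a0 sab ws _ _.
    by move=> l; exact: dot_ge0.
  - by rewrite kS addrK (stepE _ _ _ s).
have gg (k : nat) : dot (g k) (g k) <= M * (rho ^+ k) ^+ 2 * dot (g 0) (g 0).
  by rewrite !(dot_energy Hs us) ?gk//; exact: decay T k.
have ge (k : nat) : H *m (x k - xstar H q) = g k by [].
have ee (k : nat) : dot (x k - xstar H q) (x k - xstar H q) <=
    a ^- 2 * (M * (rho ^+ k) ^+ 2 * dot (g 0) (g 0)).
  rewrite -ler_pdivrMl ?invr_gt0 ?exprn_gt0// invrK.
  by apply: le_trans (gg k); apply: dot_error_le sH a0 us sa (gk k).
have D0 : 0 <= dot (g 0) (g 0) by exact: dot_ge0.
split.
- move=> k; apply: enorm_le; first by rewrite !mulr_ge0 ?sqrtr_ge0 ?exprn_ge0 ?(ltW rho0).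
  by rewrite !exprMn sqr_enorm sqr_sqrtr//; exact: gg.
- exists (a^-1 * Num.sqrt M * enorm (g 0)) => k; apply: enorm_le.
    by rewrite !mulr_ge0 ?sqrtr_ge0 ?exprn_ge0 ?invr_ge0 ?(ltW rho0) ?(ltW a0).
  apply: le_trans (ee k) _; rewrite !exprMn sqr_enorm sqr_sqrtr// exprVn.
  by rewrite le_eqVlt; apply/orP; left; apply/eqP; ring.
- exists ((a ^- 2 + 1) * M * dot (g 0) (g 0)) => k.
  have := gap_le q (x k - xstar H q) sH; rewrite subrKC => /le_trans; apply.
  apply: le_trans (lerD (ee k) (gg k)) _.
  rewrite mulnC exprM le_eqVlt; apply/orP; left; apply/eqP; ring.
Qed.

Theorem corollary6p4 (R : realType) (Lam : set R) :
  finite_set Lam ->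
  (forall Psi : R -> R, (forall l, Lam l -> 0 < Psi l) ->
    exists C rho : R, 0 < rho < 1 /\
    forall (d : nat) (H : 'M[R]_d) (q : 'cV[R]_d) (x : int -> 'cV[R]_d),
      spd H ->
      post_warm_up_tail H q Lam (rayleigh_step Psi H) x ->
      [/\ forall k : nat,
            enorm (grad H q (x k%:Z)) <= C * rho ^+ k * enorm (grad H q (x 0)),
          exists C' : R, forall k : nat,
            enorm (x k%:Z - xstar H q) <= C' * rho ^+ k &
          exists C'' : R, forall k : nat,
            obj H q (x k%:Z) - obj H q (xstar H q) <= C'' * rho ^+ (2 * k)])
  /\
  (exists C rho : R, 0 < rho < 1 /\
    forall (d : nat) (H : 'M[R]_d) (q : 'cV[R]_d) (x : int -> 'cV[R]_d),
      spd H ->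
      post_warm_up_tail H q Lam (bb2_step H) x ->
      [/\ forall k : nat,
            enorm (grad H q (x k%:Z)) <= C * rho ^+ k * enorm (grad H q (x 0)),
          exists C' : R, forall k : nat,
            enorm (x k%:Z - xstar H q) <= C' * rho ^+ k &
          exists C'' : R, forall k : nat,
            obj H q (x k%:Z) - obj H q (xstar H q) <= C'' * rho ^+ (2 * k)]).
Proof.
move=> finL; split=> [Psi Psi_gt0|].
  apply: (tail_rlinear (w := Psi) (step := fun d => @rayleigh_step R d Psi)) finL _ _.
    by move=> l Ll _; exact: Psi_gt0.
  by move=> d H v s sH us ss vs; apply: rayleigh_energy => //; exact: sH.1.
apply: (tail_rlinear (w := id) (step := @bb2_step R)) finL _ _ => //.
by move=> d H v s sH us _ vs; apply: bb2_energy => //; exact: sH.1.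
Qed.
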